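(* For any convex polygon $P$ and any $k\ge 2$, $k_{\mathrm{DIR}}\text{-CONV}\not\subseteq P_{hom}$.
   Context: All graphs are finite. A polygon is a closed convex polygon in $\mathbb{R}^2$. For a finite collection of sets, its intersection graph has one vertex for each member of the collection, and two distinct vertices are adjacent iff the corresponding sets have nonempty intersection. $P_{hom}$ is the class of intersection graphs of finite collections of sets homothetic to $P$, i.e. sets obtained from $P$ by (positive) scaling and/or translation. For a set $L$ of $k$ distinct lines through the origin in $\mathbb{R}^2$, $\mathcal{P}(L)$ is the family of all polygons each of whose sides is parallel to some line of $L$; $k_{\mathrm{DIR}(L)}\text{-CONV}$ is the class of intersection graphs of finite collections of polygons from $\mathcal{P}(L)$, and $k_{\mathrm{DIR}}\text{-CONV}$ is the union of $k_{\mathrm{DIR}(L)}\text{-CONV}$ over all sets $L$ of $k$ distinct lines through the origin. *)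

(* Defs.v *)
From HB Require Import structures.
From mathcomp Require Import all_boot all_order all_algebra.
From mathcomp Require Import all_classical all_reals all_analysis.

Set Implicit Arguments.
Unset Strict Implicit.
Unset Printing Implicit Defensive.

Import Order.TTheory GRing.Theory Num.Theory.
Import numFieldNormedType.Exports.

Local Open Scope classical_set_scope.
Local Open Scope ring_scope.

Record sgraph := SGraph {
  vertex : finType;
  adj : rel vertex;
  adj_sym : symmetric adj;
  adj_irrefl : irreflexive adj }.

Section Plane.
Variable R : realType.
Local Notation plane := 'rV[R]_2.

Definition convex_hull (A : set plane) : set plane :=
  smallest (@convex_set R plane) A.

(* The interior condition excludes the empty set, points and segments. *)
Definition polygon (P : set plane) : Prop :=
  (exists s : seq plane, P = convex_hull [set` s]) /\ P° !=set0.

Definition dot (u v : plane) : R := \sum_(i < 2) u 0 i * v 0 i.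

(* F is the intersection of P with a supporting line {x | dot u x = c} and is
   not reduced to a point. *)
Definition side (P F : set plane) : Prop :=
  exists (u : plane) (c : R),
    [/\ u != 0,
        forall x, P x -> dot u x <= c,
        F = [set x | P x /\ dot u x = c]
      & exists a b, [/\ F a, F b & a != b]].

Definition origin_line (l : {vspace plane}) : bool := \dim l == 1%N.

(* For F a side and l a line through the origin. *)
Definition parallel (F : set plane) (l : {vspace plane}) : Prop :=
  forall a b, F a -> F b -> b - a \in l.

Definition directed_polygon (L : seq {vspace plane}) (P : set plane) : Prop :=
  polygon P /\ forall F, side P F -> exists2 l, l \in L & parallel F l.

Definition homothetic (P Q : set plane) : Prop :=
  exists (s : R) (t : plane), 0 < s /\ Q = [set s *: x + t | x in P].

(* Two vertices may be assigned the same set: a finite collection is a family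
   indexed by the vertices. *)
Definition intersection_graph (C : set (set plane)) (G : sgraph) : Prop :=
  exists f : vertex G -> set plane,
    (forall x, C (f x)) /\
    (forall x y, adj x y <-> x <> y /\ f x `&` f y !=set0).

Definition hom_class (P : set plane) (G : sgraph) : Prop :=
  intersection_graph [set Q | homothetic P Q] G.

Definition kdirL_conv (L : seq {vspace plane}) (G : sgraph) : Prop :=
  intersection_graph [set Q | directed_polygon L Q] G.

Definition kdir_conv (k : nat) (G : sgraph) : Prop :=
  exists L : seq {vspace plane},
    [/\ uniq L, size L = k, all origin_line L & kdirL_conv L G].

End Plane.

(* Main.v *)
(** Crossing horizontal and vertical strips realise every K_{n,n}. In a
    representation of K_{n,n} by homothets of P, let Q be a smallest member:
    the n members of the opposite class are pairwise disjoint, all meet Q and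
    are at least as large as Q. Shrinking each of them, about a point where it
    meets Q, to the size of Q gives n disjoint translates of Q that meet Q, and
    a packing argument bounds n in terms of P only. *)

Require Import Defs.
From mathcomp Require Import all_boot all_order all_algebra.
From mathcomp Require Import all_classical all_reals all_analysis.
From mathcomp Require Import zify ring lra.

Import Order.TTheory GRing.Theory Num.Theory.
Import numFieldNormedType.Exports.

Local Open Scope classical_set_scope.
Local Open Scope ring_scope.

(** * Convex hulls, homothets and the packing bound *)

Lemma convex_setE (R : realType) (A : set 'rV[R]_2) :
  @convex_set R 'rV[R]_2 A <->
  forall x y l, 0 <= l -> l <= 1 -> A x -> A y -> A (l *: x + (1 - l) *: y).
Proof.
split=> [cA x y l l0 l1 Ax Ay|cA x y l].
  by apply/set_mem; exact: (cA x y (Itv01 l0 l1) (mem_set Ax) (mem_set Ay)).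
rewrite !inE => Ax Ay.
have l0 : 0 <= l%:num by [].
have l1 : l%:num <= 1 by [].
exact: (cA x y l%:num l0 l1 Ax Ay).
Qed.

Lemma convex_hull_convex (R : realType) (A : set 'rV[R]_2) :
  @convex_set R 'rV[R]_2 (convex_hull A).
Proof.
apply/convex_setE => x y l l0 l1 Ax Ay B [cB AB].
by apply: (proj1 (convex_setE _ _)) => //; [exact: Ax|exact: Ay].
Qed.

(** Each slab [|z 0 i| <= M] is convex, so it contains the hull as soon as it contains the
    generators; summing their l1 norms gives one [M] for both coordinates. *)
Lemma convex_hull_seq_bounded (R : realType) (s : seq 'rV[R]_2) :
  exists2 M, 0 <= M & forall x i, convex_hull [set` s] x -> `|x 0 i| <= M.
Proof.
pose N (x : 'rV[R]_2) := \sum_(i < 2) `|x 0 i|.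
have N0 x : 0 <= N x by apply: sumr_ge0.
exists (\sum_(x <- s) N x); first exact: sumr_ge0.
move=> x i Cx.
apply: (Cx [set z : 'rV[R]_2 | `|z 0 i| <= \sum_(x <- s) N x]).
split=> [|{Cx} x /= xs]; last first.
  rewrite (big_rem x)//= {1}/N (bigD1 i)//= -addrA lerDl addr_ge0//.
    exact: sumr_ge0.
  exact: sumr_ge0.
apply/convex_setE => y z l l0 l1 /= yM zM; rewrite !mxE.
apply: le_trans (ler_normD _ _) _; rewrite !normrM (ger0_norm l0).
rewrite (@ger0_norm _ (1 - l)) ?subr_ge0//; nra.
Qed.

(* A homothet of P of ratio at least s0 contains a copy of P of ratio s0
   through each of its points. *)
Lemma homothet_shrink (R : realType) (P : set 'rV[R]_2) (s0 s : R)
    (t q z : 'rV[R]_2) :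
  @convex_set R 'rV[R]_2 P -> 0 < s0 -> s0 <= s -> P q -> P z ->
  [set s *: x + t | x in P] (s *: q + t + s0 *: (z - q)).
Proof.
move=> /convex_setE cP s00 s0s Pq Pz.
have s_gt0 : 0 < s by exact: lt_le_trans s0s.
(* The preimage of the target point under [x |-> s *: x + t]; it lies between [z] and [q] because
   [s0 / s <= 1]. *)
exists (s0 / s *: z + (1 - s0 / s) *: q).
  by apply: cP => //; [exact: divr_ge0 (ltW _) (ltW _)|rewrite ler_pdivrMr ?mul1r].
by apply/rowP => i; rewrite !mxE; field; rewrite gt_eqF.
Qed.

Lemma truncn_eq_dist (R : realType) (u v : R) :
  0 <= u -> 0 <= v -> Num.truncn u = Num.truncn v -> `|u - v| < 1.
Proof.
move=> /truncn_itv/andP[u1 u2] /truncn_itv/andP[v1 v2] uv.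
move: u1 u2; rewrite uv => u1 u2; move: u2 v2; rewrite -natr1 => u2 v2.
by rewrite ltr_norml; apply/andP; split; lra.
Qed.

(** Pigeonhole on a square grid: if two centres of the shrunken copies fell into one cell, the
    centre of one copy would lie in the ball inscribed in the other, contradicting disjointness. *)
Lemma homothets_packing (R : realType) (P : set 'rV[R]_2) : polygon P ->
  exists N : nat, forall n (s : 'I_n -> R) (t : 'I_n -> 'rV[R]_2) s0 t0,
    0 < s0 -> (forall j, s0 <= s j) ->
    (forall j, [set s j *: x + t j | x in P] `&`
               [set s0 *: x + t0 | x in P] !=set0) ->
    (forall j k, j != k -> ~ ([set s j *: x + t j | x in P] `&`
                              [set s k *: x + t k | x in P] !=set0)) ->
    (n <= N)%N.
Proof.
move=> [[S PS] [p /nbhs_ballP[e /= e0 peP]]].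
have cP : @convex_set R 'rV[R]_2 P by rewrite PS; exact: convex_hull_convex.
have [M M0 PM] : exists2 M, 0 <= M & forall x i, P x -> `|x 0 i| <= M.
  by rewrite PS; exact: convex_hull_seq_bounded.
(* Normalised centres have coordinates in [[-3 * M, 3 * M]]; cells of width [e] then number at most
   [K.+1] per axis. *)
have Pp : P p by exact/peP/ballxx.
pose K := Num.truncn (6 * M / e).
exists (K.+1 ^ 2)%N => n s t s0 t0 s00 s0s meet disj.
have pts j : exists qr : 'rV[R]_2 * 'rV[R]_2,
    [/\ P qr.1, P qr.2 & s j *: qr.1 + t j = s0 *: qr.2 + t0].
  by have [y [[q Pq <-] [r Pr rq]]] := meet j; exists (q, r).
have [f fP] := choice pts.
(* Centres of inscribed balls of radius e, after rescaling by 1 / s0. *)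
pose w j : 'rV[R]_2 := (f j).2 + p - (f j).1.
(* The shift by [3 * M] makes the values nonnegative, where [Num.truncn] is the integer part; the
   division by [e] turns cells into unit intervals. *)
pose u j i := (w j 0 i + 3 * M) / e.
have wM j i : `|w j 0 i| <= 3 * M.
  have [/(PM _ i) + /(PM _ i) + _] := fP j; have := PM _ i Pp.
  by rewrite !mxE !ler_norml => /andP[? ?] /andP[? ?] /andP[? ?]; apply/andP; split; lra.
have u0 j i : 0 <= u j i.
  by apply: divr_ge0 (ltW e0); have := wM j i; rewrite ler_norml => /andP[? ?]; lra.
have uK j i : (Num.truncn (u j i) < K.+1)%N.
  rewrite ltnS; apply: le_truncn; rewrite ler_pM2r ?invr_gt0//.
  by have := wM j i; rewrite ler_norml => /andP[? ?]; lra.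
pose cell j := [ffun i => Ordinal (uK j i)].
suff /leq_card : injective cell by rewrite card_ffun !card_ord.
move=> j k jk; apply/eqP/negP => /negP jNk; apply: (disj j k jNk).
have [Pj _ ej] := fP j; have [Pk _ ek] := fP k.
(* The centre of copy [j]. In copy [k] it is the image of [p + (w j - w k)], which lies in the ball
   of radius [e] around [p]; balls are entrywise, so the grid estimate applies per coordinate. *)
exists (s j *: (f j).1 + t j + s0 *: (p - (f j).1)); split.
  exact: homothet_shrink.
have -> : s j *: (f j).1 + t j + s0 *: (p - (f j).1) =
    s k *: (f k).1 + t k + s0 *: (p + (w j - w k) - (f k).1).
  by rewrite ej ek; apply/rowP => i; rewrite !mxE; ring.
apply: homothet_shrink => //; apply: peP; split=> // i0 i; rewrite !ord1.
rewrite /ball/= !mxE opprD addrA subrr add0r normrN.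
have /(congr1 val)/= : cell j i = cell k i by rewrite jk.
rewrite !ffunE/= => /(truncn_eq_dist _ _ _ (u0 j i) (u0 k i)).
rewrite /u -mulrBl normrM (gtr0_norm (_ : 0 < e^-1)) ?invr_gt0//.
rewrite ltr_pdivrMr// mul1r !mxE; congr (`|_| < e).
by ring.
Qed.

(** * Axis-parallel boxes as polygons, and their sides *)

Definition box {R : realType} (a b : 'rV[R]_2) : set 'rV[R]_2 :=
  [set x | forall i, a 0 i <= x 0 i <= b 0 i].

Definition vec2 {R : realType} (x y : R) : 'rV[R]_2 :=
  \row_i (if i == 0 then x else y).

Lemma ord2P (i : 'I_2) : i = 0 \/ i = 1.
Proof. by case: i => [[|[|]]]// ?; [left|right]; exact/val_inj. Qed.

Lemma vec2_eta (R : realType) (v : 'rV[R]_2) : v = vec2 (v 0 0) (v 0 1).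
Proof. by apply/rowP => i; rewrite !mxE; have [->|->] := ord2P i. Qed.

Lemma dot2E (R : realType) (u v : 'rV[R]_2) :
  dot u v = u 0 0 * v 0 0 + u 0 1 * v 0 1.
Proof.
rewrite /dot big_ord_recl big_ord1.
by have -> : lift ord0 (ord0 : 'I_1) = 1 :> 'I_2 by exact/val_inj.
Qed.

Lemma box_convex (R : realType) (a b : 'rV[R]_2) :
  @convex_set R 'rV[R]_2 (box a b).
Proof.
apply/convex_setE => x y l l0 l1 xab yab i; rewrite !mxE.
by have /andP[? ?] := xab i; have /andP[? ?] := yab i; apply/andP; split; nra.
Qed.

Lemma convex_vec2 (R : realType) (A : set 'rV[R]_2) x1 x2 y l :
  @convex_set R 'rV[R]_2 A -> 0 <= l <= 1 ->
  A (vec2 x1 y) -> A (vec2 x2 y) -> A (vec2 (l * x1 + (1 - l) * x2) y).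
Proof.
move=> /convex_setE cA /andP[l0 l1] A1 A2.
have := cA _ _ _ l0 l1 A1 A2; congr (A _).
by apply/rowP => i; rewrite !mxE; case: ifP => // _; ring.
Qed.

(** Bilinear interpolation: a point lies between the two points of the vertical edges at its height,
    and each of these lies between two corners. *)
Lemma box_convex_hull (R : realType) (a b : 'rV[R]_2) :
  (forall i, a 0 i < b 0 i) ->
  box a b = convex_hull [set` [:: vec2 (a 0 0) (a 0 1); vec2 (a 0 0) (b 0 1);
                                  vec2 (b 0 0) (a 0 1); vec2 (b 0 0) (b 0 1)]].
Proof.
move=> ab; have ab0 := ltW (ab 0); have ab1 := ltW (ab 1).
apply/seteqP; split; last first.
  apply: smallest_sub; first exact: box_convex.
  move=> x /=; rewrite !inE => /or4P[] /eqP -> i;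
    by have [->|->] := ord2P i; rewrite !mxE/= ?lexx ?ab0 ?ab1.
move=> x xab B [/convex_setE cB sB].
pose l i := (b 0 i - x 0 i) / (b 0 i - a 0 i).
have ba i : 0 < b 0 i - a 0 i by rewrite subr_gt0.
have l0 i : 0 <= l i.
  by apply: divr_ge0 (ltW _) => //; rewrite subr_ge0; have /andP[] := xab i.
have l1 i : l i <= 1.
  by rewrite ler_pdivrMr// mul1r lerD2l lerN2; have /andP[] := xab i.
have lE i : l i * a 0 i + (1 - l i) * b 0 i = x 0 i.
  by rewrite /l; field; rewrite gt_eqF.
have edge y : y = a 0 0 \/ y = b 0 0 -> B (vec2 y (x 0 1)).
  move=> hy.
  have -> : vec2 y (x 0 1) = l 1 *: vec2 y (a 0 1) + (1 - l 1) *: vec2 y (b 0 1).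
    apply/rowP => i; have [->|->] := ord2P i; rewrite !mxE/= ?lE//; ring.
  by apply: cB => //; apply: sB => /=; rewrite !inE; case: hy => ->;
    rewrite eqxx ?orbT.
have -> : x = l 0 *: vec2 (a 0 0) (x 0 1) + (1 - l 0) *: vec2 (b 0 0) (x 0 1).
  apply/rowP => i; have [->|->] := ord2P i; rewrite !mxE/= ?lE//; ring.
by apply: cB => //; apply: edge; [left|right].
Qed.

Lemma box_polygon (R : realType) (a b : 'rV[R]_2) :
  (forall i, a 0 i < b 0 i) -> polygon (box a b).
Proof.
move=> ab; split; first by rewrite box_convex_hull//; eexists.
(* Half the shorter side: the sup-norm ball of this radius around the centre fits in the box. *)
pose r := Num.min (b 0 0 - a 0 0) (b 0 1 - a 0 1) / 2.
have rab i : r <= (b 0 i - a 0 i) / 2.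
  by rewrite ler_pM2r ?invr_gt0// ge_min; have [->|->] := ord2P i; rewrite lexx ?orbT.
exists (2^-1 *: (a + b)); apply/nbhs_ballP; exists r => /=.
  by rewrite divr_gt0// lt_min !subr_gt0 !ab.
move=> z [_ zr] i; have := zr 0 i; rewrite /ball/= !mxE ltr_norml => /andP[? ?].
by have := rab i => ?; apply/andP; split; lra.
Qed.

(** When one coordinate of the normal [u] vanishes, [dot u x = c] fixes the other coordinate of
    [x]. *)
Lemma box_side_parallel (R : realType) (a b : 'rV[R]_2) (F : set 'rV[R]_2) :
  side (box a b) F -> exists i, forall x y, F x -> F y -> x 0 i = y 0 i.
Proof.
move=> [u [c [u0 uc -> [x [y [Fx Fy xy]]]]]].
have [u00|u0N] := eqVneq (u 0 0) 0.
  have u1N : u 0 1 != 0.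
    apply: contraNneq u0 => u01; apply/eqP/rowP => i; rewrite mxE.
    by have [->|->] := ord2P i.
  exists 1 => x' y' [_ <-] [_]; rewrite !dot2E u00 !mul0r !add0r.
  by move=> /(mulfI u1N).
have [u01|u1N] := eqVneq (u 0 1) 0.
  exists 0 => x' y' [_ <-] [_]; rewrite !dot2E u01 !mul0r !addr0.
  by move=> /(mulfI u0N).
(* Otherwise dot u attains its maximum on the box at a single corner. *)
pose k i := if 0 < u 0 i then b 0 i else a 0 i.
have kmax i z : box a b z -> 0 <= u 0 i * (k i - z 0 i).
  move=> /(_ i)/andP[az zb]; rewrite /k; case: ltP => ui.
    by rewrite mulr_ge0 ?subr_ge0// ltW.
  by rewrite mulr_le0 ?subr_le0.
have kbox : box a b (vec2 (k 0) (k 1)).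
  move=> i; have /andP[ax xb] := Fx.1 i; have ab := le_trans ax xb.
  have -> : vec2 (k 0) (k 1) 0 i = k i.
    by have [->|->] := ord2P i; rewrite mxE.
  by rewrite /k; case: ifP; rewrite lexx ab.
have FE z : box a b z /\ dot u z = c -> z = vec2 (k 0) (k 1).
  move=> [zab uz]; have := uc _ kbox; rewrite -uz !dot2E !mxE/= => le.
  have k0 := kmax 0 _ zab; have k1 := kmax 1 _ zab.
  (* Two nonnegative terms with sum at most 0 both vanish. *)
  have /eqP : u 0 0 * (k 0 - z 0 0) = 0 by lra.
  have /eqP : u 0 1 * (k 1 - z 0 1) = 0 by lra.
  rewrite !mulf_eq0 (negPf u0N) (negPf u1N)/= !subr_eq0 => /eqP-> /eqP->.
  exact: vec2_eta.
by move: xy; rewrite (FE x Fx) (FE y Fy) eqxx.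
Qed.

(** * A set of [k] directions containing both axes *)

(** The vertical axis and the lines of slope 0, ..., k - 2; the horizontal axis is among them once
    [2 <= k]. *)
Definition slopes (R : realType) (k : nat) : seq {vspace 'rV[R]_2} :=
  <[vec2 0 1]>%VS :: [seq <[vec2 1 (m%:R)]>%VS | m <- iota 0 k.-1].

Lemma slopes_uniq (R : realType) (k : nat) : uniq (slopes R k).
Proof.
have slope (v : 'rV[R]_2) (m : nat) :
    v \in <[vec2 1 m%:R]>%VS -> v 0 1 = v 0 0 * m%:R.
  by move=> /vlineP[c ->]; rewrite !mxE/= mulr1.
rewrite /slopes/=; apply/andP; split.
  apply/mapP => -[m _ E]; have := memv_line (vec2 (0 : R) 1).
  rewrite E => /slope; rewrite !mxE/= mul0r.
  by move=> /eqP; rewrite oner_eq0.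
rewrite map_inj_uniq ?iota_uniq// => m m' E.
have := memv_line (vec2 (1 : R) m%:R); rewrite E => /slope.
by rewrite !mxE/= mul1r => /eqP; rewrite eqr_nat => /eqP.
Qed.

Lemma slopes_origin_line (R : realType) (k : nat) :
  all (@origin_line R) (slopes R k).
Proof.
have line (x y : R) : vec2 x y 0 0 != 0 \/ vec2 x y 0 1 != 0 ->
    origin_line <[vec2 x y]>%VS.
  move=> xy; rewrite /origin_line dim_vline.
  by case: (eqVneq (vec2 x y) 0) xy => // ->; rewrite !mxE eqxx => -[].
rewrite /slopes/= line ?mxE/= ?oner_eq0; last by right.
by apply/allP => _ /mapP[m _ ->]; apply: line; left; rewrite mxE/= oner_eq0.
Qed.

Lemma box_directed (R : realType) (k : nat) (a b : 'rV[R]_2) :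
  (2 <= k)%N -> (forall i, a 0 i < b 0 i) ->
  directed_polygon (slopes R k) (box a b).
Proof.
move=> k2 ab; split; first exact: box_polygon.
move=> F /box_side_parallel[i Fi]; have [E|E] := ord2P i; subst i.
  exists <[vec2 0 1]>%VS; first by rewrite inE eqxx.
  move=> x y Fx Fy; apply/vlineP; exists (y 0 1 - x 0 1).
  apply/rowP => i; have [->|->] := ord2P i; rewrite !mxE/=.
    by rewrite (Fi _ _ Fx Fy) subrr mulr0.
  by rewrite mulr1.
exists <[vec2 1 0]>%VS.
  rewrite inE; apply/orP; right; apply/mapP; exists 0%N => //.
  by case: k k2 => [|[|k]].
move=> x y Fx Fy; apply/vlineP; exists (y 0 0 - x 0 0).
apply/rowP => i; have [->|->] := ord2P i; rewrite !mxE/=; first by rewrite mulr1.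
by rewrite (Fi _ _ Fx Fy) subrr mulr0.
Qed.

(** * Complete bipartite graphs from crossing strips *)

Definition bip_adj (n : nat) (u v : bool * 'I_n) := u.1 != v.1.

Lemma bip_adj_sym (n : nat) : symmetric (@bip_adj n).
Proof. by move=> u v; rewrite /bip_adj eq_sym. Qed.

Lemma bip_adj_irrefl (n : nat) : irreflexive (@bip_adj n).
Proof. by move=> u; rewrite /bip_adj eqxx. Qed.

Definition complete_bipartite (n : nat) :=
  SGraph (bip_adj_sym n) (bip_adj_irrefl n).

(** Unit-width strips at even offsets leave gaps between parallel ones; length [2 * n] lets each
    cross every strip of the other direction. *)
Definition strip (R : realType) (n : nat) (v : bool * 'I_n) : set 'rV[R]_2 :=
  if v.1 then box (vec2 0 (2 * v.2)%:R) (vec2 (2 * n)%:R (2 * v.2).+1%:R)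
  else box (vec2 (2 * v.2)%:R 0) (vec2 (2 * v.2).+1%:R (2 * n)%:R).

Lemma complete_bipartite_kdir (R : realType) (k n : nat) :
  (2 <= k)%N -> kdir_conv R k (complete_bipartite n).
Proof.
move=> k2; exists (slopes R k); split.
- exact: slopes_uniq.
- by rewrite /= size_map size_iota prednK// (ltn_trans _ k2).
- exact: slopes_origin_line.
exists (@strip R n); split=> [[b j]|[b j] [b' j']] /=.
  have n0 : 0 < (2 * n)%:R :> R.
    by rewrite ltr0n muln_gt0/= (leq_ltn_trans _ (ltn_ord j)).
  by case: b; apply: box_directed => // i; have [->|->] := ord2P i;
    rewrite !mxE/= ?ltr_nat.
rewrite /bip_adj/=; split=> [bb'|[xy [z [zj zj']]]].
  split=> [[E]|]; first by rewrite E eqxx in bb'.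
  have j2 (m : 'I_n) : (2 * m)%:R <= (2 * n)%:R :> R.
    by rewrite ler_nat leq_pmul2l// ltnW.
  (* The lower left corner of the unit square where the two strips cross. *)
  exists (if b then vec2 (2 * j')%:R (2 * j)%:R else vec2 (2 * j)%:R (2 * j')%:R).
  by case: b b' bb' => [] [] // _; split=> i; have [->|->] := ord2P i;
    rewrite !mxE/= ?ler0n ?j2 ?lexx ?ler_nat ?leqnSn.
apply/negP => /eqP E; subst b'; apply: xy; congr pair.
(* A common point of parallel strips gives [2 * j <= 2 * j' + 1] and the converse bound, so [j = j']
   by parity. *)
have strip_inj (y : R) : (2 * j)%:R <= y <= (2 * j).+1%:R ->
    (2 * j')%:R <= y <= (2 * j').+1%:R -> j = j'.
  move=> /andP[h1 h2] /andP[h3 h4]; apply/val_inj => /=.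
  have := le_trans h1 h4; have := le_trans h3 h2.
  by rewrite !ler_nat; lia.
case: b zj zj' => zj zj'; [have := zj 1; have := zj' 1|have := zj 0; have := zj' 0];
  by rewrite !mxE/= => h' h; exact: strip_inj h h'.
Qed.

Theorem proposition1 (R : realType) (P : set 'rV[R]_2) (k : nat)
  (hP : polygon P) (hk : (2 <= k)%N) :
  ~ (forall G : sgraph, kdir_conv R k G -> hom_class P G).
Proof.
have [N packing] := homothets_packing _ _ hP.
pose G := complete_bipartite N.+1.
move=> /(_ G (complete_bipartite_kdir R k N.+1 hk)) [f [fP fG]].
have homP (v : bool * 'I_N.+1) : exists st : R * 'rV[R]_2,
    0 < st.1 /\ f v = [set st.1 *: x + st.2 | x in P].
  by have [s [t [s0 E]]] := fP v; exists (s, t).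
have [g gP] := choice homP.
(* The smallest ratio is taken over both classes; the packing bound then applies to the [N.+1]
   members of class [~~ b]. *)
have [[b i] _ min] := @Order.TotalTheory.arg_minP _ R _ (true, ord0) predT
  (fun v => (g v).1) isT.
suff : (N.+1 <= N)%N by rewrite ltnn.
apply: (packing _ (fun j => (g (~~ b, j)).1) (fun j => (g (~~ b, j)).2)
                _ (g (b, i)).2 (gP (b, i)).1).
- by move=> j; exact: min.
- move=> j; rewrite -(gP _).2 -(gP _).2.
  by have [] : (~~ b, j) <> (b, i) /\ f (~~ b, j) `&` f (b, i) !=set0
    by apply/fG; rewrite /= /bip_adj/=; case: b {min}.
- move=> j l jl; rewrite -(gP _).2 -(gP _).2 => meet.
  have : @adj G (~~ b, j) (~~ b, l).
    by apply/fG; split=> // -[] /eqP; rewrite (negPf jl).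
  by rewrite /= /bip_adj eqxx.
Qed.
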